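(* Let $c \geq 2$ be a fixed integer. Then there exist a constant $L = L(c) > 0$, depending only on $c$, and an integer $n_0 = n_0(c)$ such that for all $n \geq n_0$, $$X_{\leq (c-1)}^{(c)}(n) \geq L n^2.$$
   Context: A finite set of points in $\mathbb{R}^2$ is in general position if no three of its points lie on a line. A $c$-colored point set is a finite set $P \subset \mathbb{R}^2$ together with an arbitrary assignment of a color from $\{1,2,\ldots,c\}$ to each point of $P$. A triangle determined by $P$ is a triangle whose three vertices are points of $P$; it is monochromatic if its three vertices have the same color. For a finite $c$-colored point set $P \subset \mathbb{R}^2$ in general position and an integer $s \geq 0$, $X_{\leq s}^{(c)}(P)$ denotes the number of monochromatic triangles determined by $P$ that contain at most $s$ points of $P$ (of any color) in their interior. Define $$X_{\leq s}^{(c)}(n) := \min_{P} X_{\leq s}^{(c)}(P),$$ where the minimum is over all $c$-colored point sets $P \subset \mathbb{R}^2$ in general position with $|P| = n$. *)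

(* Defs.v *)
From HB Require Import structures.
From mathcomp Require Import all_boot all_order all_algebra finmap.
From mathcomp Require Import boolp classical_sets reals topology normedtype convex.

Set Implicit Arguments.
Unset Strict Implicit.
Unset Printing Implicit Defensive.

Import Order.TTheory GRing.Theory Num.Theory.
Import numFieldNormedType.Exports.

Local Open Scope classical_set_scope.
Local Open Scope ring_scope.

Definition is_line (R : realType) (l : set 'rV[R]_2) : Prop :=
  exists a d : 'rV[R]_2, d != 0 /\ l = [set a + t *: d | t in [set: R]].

Definition general_position (R : realType) (P : {fset 'rV[R]_2}) : Prop :=
  forall p q r, p \in P -> q \in P -> r \in P ->
    p != q -> q != r -> p != r ->
    ~ exists l, [/\ is_line l, l p, l q & l r].

Definition convex_hull (R : realType) (A : set 'rV[R]_2) : set 'rV[R]_2 :=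
  smallest (@convex_set R 'rV[R]_2) A.

(* A triangle determined by [P] is identified with its set of three vertices, a
   set over the finite type [P] of elements of [P]; [fsval : P -> 'rV_2] gives
   the underlying points. *)
Definition triangle_region (R : realType) (P : {fset 'rV[R]_2}) (T : {set P}) :
    set 'rV[R]_2 :=
  convex_hull [set fsval p | p in [set p : P | p \in T]].

Definition interior_points (R : realType) (P : {fset 'rV[R]_2})
    (T : {set P}) : {set P} :=
  finset (fun q : P => fsval q \in ((triangle_region T)° : set 'rV[R]_2)).

Definition monochromatic (R : realType) (c : nat) (P : {fset 'rV[R]_2})
    (chi : P -> 'I_c) (T : {set P}) : bool :=
  [forall p in T, forall q in T, chi p == chi q].

Definition num_mono_triangles (R : realType) (c s : nat) (P : {fset 'rV[R]_2})
    (chi : P -> 'I_c) : nat :=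
  #|finset (fun T : {set P} => [&& #|T| == 3%N, monochromatic chi T
                                 & (#|interior_points T| <= s)%N])|.

Definition attained (R : realType) (c s n m : nat) : Prop :=
  exists (P : {fset 'rV[R]_2}) (chi : P -> 'I_c),
    [/\ general_position P, #|` P| = n & num_mono_triangles s chi = m].

(* The minimum over all [c]-colored point sets of size [n] in general position;
   the default value [0] is only used when there is none, i.e. when [c = 0] and
   [n > 0] (see [min_mono_trianglesP]). *)
Definition min_mono_triangles (R : realType) (c s n : nat) : nat :=
  if pselect (exists m, `[< attained R c s n m >]) is left ex
  then ex_minn ex else 0%N.

Definition parabola (R : realType) (x : R) : 'rV[R]_2 :=
  \row_(i < 2) x ^+ i.+1.

Lemma parabola_not_collinear (R : realType) (x y z : R) (l : set 'rV[R]_2) :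
  x != y -> y != z -> x != z ->
  ~ [/\ is_line l, l (parabola x), l (parabola y) & l (parabola z)].
Proof.
move=> xy yz xz [[a [d [d0 ->]]] [t _ +] [u _ +] [v _ +]].
have coord w s : a + s *: d = parabola w ->
    w = a 0 0 + s * d 0 0 /\ w ^+ 2 = a 0 1 + s * d 0 1.
  by move=> e; split; move/rowP: e => e; [move: (e 0)|move: (e 1)]; rewrite !mxE.
move=> /coord[x1 x2] /coord[y1 y2] /coord[z1 z2].
have slope w w' s s' : w = a 0 0 + s * d 0 0 -> w ^+ 2 = a 0 1 + s * d 0 1 ->
    w' = a 0 0 + s' * d 0 0 -> w' ^+ 2 = a 0 1 + s' * d 0 1 -> w != w' ->
    (w + w') * d 0 0 = d 0 1.
  move=> e1 e2 f1 f2 ww'.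
  have ss' : s - s' != 0.
    by apply: contraNneq ww' => /subr0_eq ss'; rewrite e1 f1 ss'.
  apply: (mulfI ss'); rewrite mulrCA -[RHS]addr0.
  have -> : (s - s') * d 0 0 = w - w' by rewrite e1 f1 opprD addrACA subrr add0r -mulrBl.
  have -> : (s - s') * d 0 1 = w ^+ 2 - w' ^+ 2 by rewrite e2 f2 opprD addrACA subrr add0r -mulrBl.
  by rewrite addr0 subr_sqr mulrC.
have exy := slope _ _ _ _ x1 x2 y1 y2 xy.
have eyz := slope _ _ _ _ y1 y2 z1 z2 yz.
have d00 : d 0 0 = 0.
  apply/eqP; have : (x - z) * d 0 0 == 0.
    have -> : x - z = (x + y) - (y + z) by rewrite addrKA.
    by rewrite mulrBl exy eyz subrr.
  by rewrite mulf_eq0 subr_eq0 (negPf xz).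
by move: xy; rewrite x1 y1 d00 !mulr0 eqxx.
Qed.

Lemma min_mono_trianglesP (R : realType) (c s n : nat) : (0 < c)%N ->
  attained R c s n (min_mono_triangles R c s n) /\
  (forall m, attained R c s n m -> (min_mono_triangles R c s n <= m)%N).
Proof.
move=> c0; rewrite /min_mono_triangles; case: pselect => [ex|[]].
  case: ex_minnP => m /asboolP am mmin; split => // k ak.
  by apply: mmin; apply/asboolP.
have par_inj : injective (fun k : nat => parabola (k%:R : R)).
  move=> i j /rowP /(_ 0); rewrite !mxE !expr1 => /eqP.
  by rewrite eqr_nat => /eqP.
pose P := seq_fset tt [seq parabola (k%:R : R) | k <- iota 0 n].
pose chi (p : P) := Ordinal c0.
exists (num_mono_triangles s chi); apply/asboolP; exists P, chi; split => //.
- move=> p q r; rewrite !seq_fsetE => /mapP[i _ ->] /mapP[j _ ->] /mapP[k _ ->].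
  move=> ij jk ik [l]; apply: parabola_not_collinear.
  + by apply: contraNneq ij => ->.
  + by apply: contraNneq jk => ->.
  + by apply: contraNneq ik => ->.
- by rewrite size_seq_fset undup_id ?map_inj_uniq ?iota_uniq ?size_map ?size_iota.
Qed.

(* Main.v *)
Require Import Defs.
From mathcomp Require Import boolp classical_sets reals interval_inference.
From mathcomp Require Import topology normedtype convex.
From mathcomp Require Import all_boot all_order all_algebra finmap.
From mathcomp Require Import ring lra zify.

Import Order.TTheory GRing.Theory Num.Theory.
Import numFieldNormedType.Exports.
Local Open Scope ring_scope.

(* Let [S] be a largest color class, so that [n <= c * m] with [m = #|S|], and fix
   a linear form that is injective on the points.  For [p] in [S], sort by slope
   from [p] the points of [S] on its right.  The triangles formed by [p] and two
   consecutive points have disjoint interiors, which contain no point of [S]; as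
   there are only [n - m <= (c - 1) * m] other points, at most [m - m / c] of these
   triangles contain [c] points or more.  If [p] is among the first [m / (4 c)]
   points of [S], this leaves at least [m / (2 c)] triangles, and triangles with
   distinct leftmost vertices [p] are distinct. *)

(** * Counting in finite sets *)

Lemma sum_card_disjoint {I T : finType} (D : {set I}) (F : I -> {set T})
    (B : {set T}) :
  (forall i, i \in D -> F i \subset B) ->
  (forall i j z, i \in D -> j \in D -> z \in F i -> z \in F j -> i = j) ->
  (\sum_(i in D) #|F i| <= #|B|)%N.
Proof.
move=> FB Finj.
rewrite (eq_bigr (fun i => \sum_(z in B) (z \in F i : nat)))%N; last first.
  move=> i /FB FiB; rewrite -big_mkcondr /= sum1dep_card.
  apply: eq_card => z; rewrite !inE.
  by apply/idP/andP => [zF|[]//]; rewrite (subsetP FiB).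
rewrite exchange_big /= -sum1_card; apply: leq_sum => z _.
have [[i iD zi]|none] := pselect (exists2 i, i \in D & z \in F i).
  rewrite (bigD1 i)//= zi big1 // => j /andP[jD ji].
  by apply/eqP; rewrite eqb0; apply: contraNN ji => zj; apply/eqP/(Finj _ _ z).
rewrite big1 // => i iD; apply/eqP; rewrite eqb0.
by apply/negP => zi; apply: none; exists i.
Qed.

(* [I q r] stands for the set of points inside the triangle [p q r] with a fixed
   apex [p], and [U] for the points of the other colors. *)
Lemma few_interior_consecutive {d : Order.disp_t} {K : orderType d} {T : finType}
    (key : T -> K) (Q U : {set T}) (I : T -> T -> {set T}) (s : nat) :
  {in Q &, injective key} ->
  (forall q r z, q \in Q -> r \in Q -> (key q < key r)%O -> z \in I q r ->
    (key q < key z < key r)%O /\ z \in Q :|: U) ->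
  exists (D : {set T}) (succ : T -> T),
    (forall q, q \in D -> [/\ q \in Q, succ q \in Q, (key q < key (succ q))%O
                            & (#|I q (succ q)| <= s)%N]) /\
    (#|Q|.-1 * s.+1 <= #|D| * s.+1 + #|U|)%N.
Proof.
move=> kinj IP.
pose above q := [pred r | (r \in Q) && (key q < key r)%O].
pose Q' := finset (fun q => (q \in Q) && [exists r, above q r]).
(* The next point of [Q] in key order; the default [q] is returned only when no point of [Q] lies
   above [q]. *)
pose succ q := if [pick r | above q r] is Some r
  then [arg min_(r' < r | above q r') key r']%O else q.
have succP q : q \in Q' -> [/\ succ q \in Q, (key q < key (succ q))%O
    & forall r, r \in Q -> (key q < key r)%O -> (key (succ q) <= key r)%O].
  rewrite inE => /andP[qQ /existsP[r0 r0P]]; rewrite /succ.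
  case: pickP => [r rP|/(_ r0)]; last by rewrite r0P.
  case: arg_minP => // i /andP[iQ qi] imin; split => // j jQ qj.
  by apply: imin; rewrite /= jQ.
have Q'Q : Q' \subset Q by apply/subsetP => q; rewrite inE => /andP[].
(* Only a point of [Q] with maximal key has no successor, and injectivity of [key] leaves at most
   one such point. *)
have cardQ' : (#|Q|.-1 <= #|Q'|)%N.
  have : (#|Q :\: Q'| <= 1)%N.
    apply/card_le1P => q /setDP[qQ qQ'] r.
    apply/setDP/eqP => [[rQ rQ']|->]; last by [].
    have notlt x y : x \in Q -> y \in Q ->
        ~~ ((x \in Q) && [exists r, above x r]) -> (key y <= key x)%O.
      move=> xQ yQ; rewrite xQ /= => /existsPn /(_ y) /=.
      by rewrite yQ /= -leNgt.
    apply: kinj => //; apply: le_anti.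
    move: qQ' rQ'; rewrite !inE => qQ' rQ'.
    by rewrite (notlt q r)//= (notlt r q).
  by rewrite cardsD (setIidPr Q'Q); lia.
pose D := finset (fun q => (q \in Q') && (#|I q (succ q)| <= s)%N).
exists D, succ; split.
  move=> q; rewrite inE => /andP[qQ' Is]; have [? ? _] := succP _ qQ'.
  by split => //; exact: (subsetP Q'Q).
have DQ' : D \subset Q' by apply/subsetP => q; rewrite inE => /andP[].
(* The keys of [I q (succ q)] lie strictly between those of [q] and [succ q], and these intervals
   are disjoint for distinct [q]. *)
have dis q q' z : q \in Q' -> q' \in Q' -> z \in I q (succ q) ->
    z \in I q' (succ q') -> q = q'.
  wlog qq' : q q' / (key q <= key q')%O.
    move=> wl qQ q'Q zq zq'; case/orP: (le_total (key q) (key q')) => le.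
      exact: wl.
    by symmetry; exact: wl.
  move=> qQ' q'Q' zq zq'.
  have [sqQ qs qmin] := succP _ qQ'; have [sqQ' q's q'min] := succP _ q'Q'.
  have qQ := subsetP Q'Q _ qQ'; have q'Q := subsetP Q'Q _ q'Q'.
  have [/andP[_ zs] _] := IP _ _ _ qQ sqQ qs zq.
  have [/andP[q'z _] _] := IP _ _ _ q'Q sqQ' q's zq'.
  move: qq'; rewrite le_eqVlt => /predU1P[/kinj ->//|lt].
  have := lt_trans q'z zs; rewrite ltNge; move/negP; case.
  exact: qmin.
have IU q : q \in Q' -> I q (succ q) \subset U.
  move=> qQ'; have [sqQ qs qmin] := succP _ qQ'.
  have qQ := subsetP Q'Q _ qQ'.
  apply/subsetP => z zI; have [/andP[qz zs]] := IP _ _ _ qQ sqQ qs zI.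
  by rewrite inE => /orP[zQ|//]; move: zs; rewrite ltNge qmin.
(* Each [q] outside [D] uses up at least [s.+1] points of [U], and no point of [U] is used twice. *)
have : (\sum_(q in Q' :\: D) #|I q (succ q)| <= #|U|)%N.
  apply: sum_card_disjoint => [q /setDP[qQ' _]|q q' z /setDP[? _] /setDP[? _]].
    exact: IU.
  exact: dis.
have : (\sum_(q in Q' :\: D) s.+1 <= \sum_(q in Q' :\: D) #|I q (succ q)|)%N.
  apply: leq_sum => q /setDP[qQ']; rewrite inE qQ' /=; lia.
rewrite sum_nat_const cardsD (setIidPr DQ').
have := subset_leq_card DQ'; nia.
Qed.

(** Sort [S] by [f] and let [A] be its first [k] points: the other [#|S| - k] points lie above each
    of them. *)
Lemma many_have_many_above {d : Order.disp_t} {K : orderType d} {T : finType}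
    (f : T -> K) (S : {set T}) (k : nat) :
  injective f -> (k <= #|S|)%N ->
  exists2 A : {set T}, A \subset S /\ #|A| = k &
    forall p, p \in A ->
      (#|S| - k <= #|finset (fun q => (q \in S) && (f p < f q)%O)|)%N.
Proof.
move=> finj kS.
pose le p q := (f p <= f q)%O.
have letot : total le by move=> p q; exact: le_total.
have letr : transitive le by move=> p q r; exact: le_trans.
pose s := sort le (enum S).
have us : uniq s by rewrite sort_uniq enum_uniq.
have ss : size s = #|S| by rewrite size_sort cardE.
have memS : s =i S by move=> p; rewrite mem_sort mem_enum.
have := sort_sorted letot (enum S).
rewrite -/s sorted_pairwise// -{1}(cat_take_drop k s) pairwise_cat.
case/andP => /allrelP rel _.
move: us; rewrite -{1}(cat_take_drop k s) cat_uniq => /and3P[ut /hasPn ntd ud].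
exists (finset [in take k s]).
  split; first by apply/subsetP => p; rewrite inE -memS => /mem_take.
  by rewrite cardsE (card_uniqP ut) size_takel ?ss.
move=> p; rewrite inE => pt.
rewrite -ss -size_drop -(card_uniqP ud); apply/subset_leq_card/subsetP => q qd.
rewrite inE -memS (mem_drop qd) /= lt_neqAle.
apply/andP; split; last exact: rel.
by rewrite (inj_eq finj); apply: contraNneq (ntd _ qd) => <-.
Qed.

Lemma large_color_class {T : finType} {c : nat} (chi : T -> 'I_c) :
  (0 < c)%N -> exists k, (#|T| <= c * #|finset (fun p => chi p == k)|)%N.
Proof.
move=> c0; pose S k := finset (fun p => chi p == k).
exists [arg max_(k > Ordinal c0) #|S k|]; case: arg_maxnP => // k _ kmax.
apply: (@leq_trans (\sum_(i < c) #|S k|)); last by rewrite sum_nat_const card_ord.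
rewrite -[leqLHS]sum1_card (partition_big chi predT) //=.
by apply: leq_sum => i _; apply: leq_trans (kmax i isT); rewrite sum1dep_card.
Qed.

(** * Linear forms, half-planes and slopes in the plane *)

Definition dotmul2 {R : realType} (w v : 'rV[R]_2) : R :=
  w 0 0 * v 0 0 + w 0 1 * v 0 1.

Lemma dotmul2D {R : realType} (w u v : 'rV[R]_2) :
  dotmul2 w (u + v) = dotmul2 w u + dotmul2 w v.
Proof. by rewrite /dotmul2 !mxE; ring. Qed.

Lemma dotmul2Z {R : realType} (w v : 'rV[R]_2) (a : R) :
  dotmul2 w (a *: v) = a * dotmul2 w v.
Proof. by rewrite /dotmul2 !mxE; ring. Qed.

Lemma dotmul2B {R : realType} (w u v : 'rV[R]_2) :
  dotmul2 w (u - v) = dotmul2 w u - dotmul2 w v.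
Proof. by rewrite /dotmul2 !mxE; ring. Qed.

Lemma dotmul2_gt0 {R : realType} (w : 'rV[R]_2) : w != 0 -> 0 < dotmul2 w w.
Proof.
move=> w0; rewrite /dotmul2 lt_neqAle; apply/andP; split; last first.
  by rewrite -!expr2 addr_ge0 ?sqr_ge0.
rewrite eq_sym; apply: contraNneq w0 => /eqP; rewrite -!expr2.
rewrite paddr_eq0 ?sqr_ge0 // !sqrf_eq0 => /andP[/eqP w00 /eqP w01].
apply/eqP/rowP => i; rewrite mxE.
case: i => -[|[|//]] i2; [rewrite -[RHS]w00|rewrite -[RHS]w01];
  by congr (w _ _); apply: val_inj.
Qed.

Section Geometry.
Local Open Scope classical_set_scope.

Lemma convex_hull_halfplane {R : realType} (A : set 'rV[R]_2) (w : 'rV[R]_2)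
    (c : R) : (forall p, A p -> c <= dotmul2 w p) ->
  forall z, convex_hull A z -> c <= dotmul2 w z.
Proof.
move=> Aw; apply: (smallest_sub (X := [set z | c <= dotmul2 w z])) => //.
move=> x y l /set_mem /= cx /set_mem /= cy; apply/mem_set.
rewrite /= /conv /= dotmul2D !dotmul2Z.
set t := Itv.r l; have t0 : 0 <= t by exact: (@ge0 _ _ l erefl).
have t1 : t <= 1 by exact: (@le1 _ _ l erefl).
by rewrite /unstable.onem; nra.
Qed.

(** From an interior point, a short step along [- w] stays in the hull and strictly lowers the form,
    so the bound cannot be tight there. *)
Lemma interior_hull_halfplane {R : realType} (A : set 'rV[R]_2) (w : 'rV[R]_2)
    (c : R) : w != 0 -> (forall p, A p -> c <= dotmul2 w p) ->
  forall z, (convex_hull A)° z -> c < dotmul2 w z.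
Proof.
move=> w0 Aw z /= zI.
have : (z + (e *: (- w))) @[e --> 0^'+] --> z.
  rewrite -[X in _ --> X]addr0 -(scale0r (- w)).
  apply: cvgD; first exact: cvg_cst.
  by apply: cvgZl; apply: cvg_at_right_filter; exact: cvg_id.
move=> /(_ _ zI) near_hull.
have [e [/= e0 eH]] : exists e : R, 0 < e /\ convex_hull A (z + e *: (- w)).
  near (0 : R)^'+ => e; exists e; split; first by near: e; exact: nbhs_right_gt.
  by near: e; exact: near_hull.
have := convex_hull_halfplane _ _ _ Aw _ eH.
rewrite dotmul2D dotmul2Z -scaleN1r dotmul2Z.
by have := dotmul2_gt0 _ w0; nra.
Unshelve. all: by end_near.
Qed.

Definition perp {R : realType} (w : 'rV[R]_2) : 'rV[R]_2 :=
  \row_(i < 2) if i == 0 then - w 0 1 else w 0 0.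

(** The usual slope of the line [pq] in the orthogonal frame with [w] as horizontal and [perp w] as
    vertical axis. It orders the points to the right of [p] by angle around [p]. *)
Definition slope {R : realType} (w p q : 'rV[R]_2) : R :=
  dotmul2 (perp w) (q - p) / dotmul2 w (q - p).

Lemma dotmul2_perp_inj {R : realType} (w v : 'rV[R]_2) : w != 0 ->
  dotmul2 w v = 0 -> dotmul2 (perp w) v = 0 -> v = 0.
Proof.
move=> /dotmul2_gt0 w0; rewrite /dotmul2 !mxE /= => wv pv.
have v0 : dotmul2 w w * v 0 0 = 0.
  transitivity (w 0 0 * (w 0 0 * v 0 0 + w 0 1 * v 0 1)
    - w 0 1 * (- w 0 1 * v 0 0 + w 0 0 * v 0 1)); first by rewrite /dotmul2; ring.
  by rewrite wv pv !mulr0 subr0.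
have v1 : dotmul2 w w * v 0 1 = 0.
  transitivity (w 0 1 * (w 0 0 * v 0 0 + w 0 1 * v 0 1)
    + w 0 0 * (- w 0 1 * v 0 0 + w 0 0 * v 0 1)); first by rewrite /dotmul2; ring.
  by rewrite wv pv !mulr0 addr0.
move/eqP: v0; rewrite mulf_eq0 gt_eqF //= => /eqP v0.
move/eqP: v1; rewrite mulf_eq0 gt_eqF //= => /eqP v1.
apply/rowP => i; rewrite mxE.
case: i => -[|[|//]] i2; [rewrite -[RHS]v0|rewrite -[RHS]v1];
  by congr (v _ _); apply: val_inj.
Qed.

Lemma eq_slope_collinear {R : realType} (w p q r : 'rV[R]_2) : w != 0 ->
  dotmul2 w p < dotmul2 w q -> dotmul2 w p < dotmul2 w r ->
  slope w p q = slope w p r -> exists l, [/\ is_line l, l p, l q & l r].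
Proof.
move=> w0 pq pr sl.
have pq0 : 0 < dotmul2 w (q - p) by rewrite dotmul2B subr_gt0.
have pr0 : 0 < dotmul2 w (r - p) by rewrite dotmul2B subr_gt0.
have qp0 : q - p != 0.
  by apply: contraTneq pq0 => ->; rewrite /dotmul2 !mxE !mulr0 addr0 ltxx.
exists [set p + t *: (q - p) | t in [set: R]]; split.
- by exists p, (q - p).
- by exists 0 => //; rewrite scale0r addr0.
- by exists 1 => //; rewrite scale1r addrC subrK.
(* This ratio makes the [w]-components of [r - p] and [t *: (q - p)] agree; equality of the slopes
   does the same for the [perp w]-components. *)
- pose t := dotmul2 w (r - p) / dotmul2 w (q - p); exists t => //.
  apply/esym/eqP; rewrite -subr_eq0 opprD addrA -scaleNr; apply/eqP.
  apply: (dotmul2_perp_inj w) => //; rewrite dotmul2D dotmul2Z /t.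
    by rewrite mulNr divfK ?subrr // gt_eqF.
  have -> : dotmul2 (perp w) (r - p) = slope w p q * dotmul2 w (r - p).
    by rewrite sl /slope divfK // gt_eqF.
  by rewrite /slope; field; rewrite gt_eqF.
Qed.

(** The hull lies in three half-planes whose boundaries pass through [p]: right of [p], above the
    line [pq] and below the line [pr]. Interior points satisfy all three inequalities strictly. *)
Lemma interior_triangle_slope {R : realType} (w p q r z : 'rV[R]_2)
    (A : set 'rV[R]_2) :
  w != 0 -> (forall a, A a -> [\/ a = p, a = q | a = r]) ->
  dotmul2 w p < dotmul2 w q -> dotmul2 w p < dotmul2 w r ->
  slope w p q < slope w p r -> (convex_hull A)° z ->
  dotmul2 w p < dotmul2 w z /\ slope w p q < slope w p z < slope w p r.
Proof.
move=> w0 Apqr pq pr sl zI.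
have pz : dotmul2 w p < dotmul2 w z.
  apply: interior_hull_halfplane zI => // a /Apqr[] -> //; exact: ltW.
split=> //; rewrite -!(subr_gt0 (dotmul2 w p)) -!dotmul2B in pq pr pz.
(* Pairing the normal [u] with [perp w] gives [e * dotmul2 w w], so [u] is nonzero. *)
have side k (e : R) : e != 0 -> let u := e *: perp w + k *: w in
    (forall a, A a -> 0 <= dotmul2 u (a - p)) -> 0 < dotmul2 u (z - p).
  move=> e0 u uA; rewrite dotmul2B subr_gt0; apply: interior_hull_halfplane zI.
    apply: contraTneq (dotmul2_gt0 _ w0) => u0.
    have : e * dotmul2 w w = dotmul2 (perp w) u.
      by rewrite /u /dotmul2 !mxE /=; ring.
    rewrite u0 /dotmul2 !mxE !mulr0 addr0 => /eqP.
    by rewrite mulf_eq0 (negPf e0) /= => /eqP ->; rewrite ltxx.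
  by move=> a /uA; rewrite dotmul2B subr_ge0.
have lin e k v : dotmul2 (e *: perp w + k *: w) v =
    e * dotmul2 (perp w) v + k * dotmul2 w v.
  by rewrite /dotmul2 !mxE /=; ring.
have eqs x : 0 < dotmul2 w (x - p) ->
    dotmul2 (perp w) (x - p) = slope w p x * dotmul2 w (x - p).
  by move=> x0; rewrite /slope divfK // gt_eqF.
have d0 u : dotmul2 u (p - p) = 0 by rewrite dotmul2B subrr.
(* This form vanishes at [q - p] and is positive at [r - p]; for the form in [zhigh] it is the
   reverse. *)
have zlow : 0 < dotmul2 (1 *: perp w + (- slope w p q) *: w) (z - p).
  apply: side; rewrite ?oner_eq0 // => a /Apqr[] ->;
    rewrite ?d0 // lin ?eqs //; nra.
have zhigh : 0 < dotmul2 ((-1) *: perp w + slope w p r *: w) (z - p).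
  apply: side; rewrite ?oppr_eq0 ?oner_eq0 // => a /Apqr[] ->;
    rewrite ?d0 // lin ?eqs //; nra.
move: zlow zhigh; rewrite !lin !eqs // => zlow zhigh.
by apply/andP; split; nra.
Qed.

(** For [w = (1, t)], two distinct points can get the same value only if their second coordinates
    differ and [t] is a ratio determined by the pair; some [t] avoids these finitely many ratios. *)
Lemma generic_direction {R : realType} (P : {fset 'rV[R]_2}) :
  exists2 w : 'rV[R]_2, w != 0 &
    forall p q, p \in P -> q \in P -> dotmul2 w p = dotmul2 w q -> p = q.
Proof.
pose bad := [seq (p 0 0 - q 0 0) / (q 0 1 - p 0 1) |
  p : 'rV[R]_2 <- enum_fset P, q : 'rV[R]_2 <- enum_fset P].
have [t tbad] : exists t : R, t \notin bad.
  have [t tb] : exists t, forall x, x \in bad -> x < t.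
    elim: bad => [|y s [t IH]]; first by exists 0.
    exists (Num.max t (y + 1)) => x; rewrite inE lt_max => /predU1P[->|/IH -> //].
    by rewrite ltrDl ltr01 orbT.
  by exists t; apply/negP => /tb; rewrite ltxx.
pose w : 'rV[R]_2 := \row_(i < 2) if i == 0 then 1 else t.
exists w.
  by apply/eqP => /rowP /(_ 0); rewrite !mxE /= => /eqP; rewrite oner_eq0.
move=> p q pP qP; rewrite /dotmul2 !mxE /= !mul1r => e.
have [e1|ne1] := eqVneq (p 0 1) (q 0 1).
  move: e; rewrite e1 => /addIr e0; apply/rowP => i.
  case: i => -[|[|//]] i2; [move: e0|move: e1];
    by congr (p _ _ = q _ _); apply: val_inj.
move/negP: tbad; case; apply/allpairsP; exists (p, q); split=> //=.
have d : q 0 1 - p 0 1 != 0 by rewrite subr_eq0 eq_sym.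
apply: (mulIf d); rewrite divfK //.
by move: e; lra.
Qed.

(** * Triangles grouped by leftmost vertex *)

Section Apex.
Context {R : realType} {P : {fset 'rV[R]_2}} {c : nat} (chi : P -> 'I_c) (s : nat).
Implicit Types (w : 'rV[R]_2) (p : P) (T : {set P}).

(** The set whose cardinality is, by conversion, [num_mono_triangles s chi]. *)
Definition almost_empty_triangles : {set {set P}} :=
  finset (fun T : {set P} => [&& #|T| == 3%N, monochromatic chi T
                                 & (#|interior_points T| <= s)%N]).

Definition leftmost_triangles w p : {set {set P}} :=
  finset (fun T : {set P} => [&& T \in almost_empty_triangles, p \in T &
    [forall q in T, (q != p) ==> (dotmul2 w (fsval p) < dotmul2 w (fsval q))]]).

Lemma card_leftmost_triangles w p : w != 0 -> general_position P ->
  (#|finset (fun q => (chi q == chi p)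
      && (dotmul2 w (fsval p) < dotmul2 w (fsval q))%R)|.-1 * s.+1
   <= #|leftmost_triangles w p| * s.+1 + #|finset (fun q => chi q != chi p)|)%N.
Proof.
move=> w0 gp.
set Q := finset _; set U := finset (fun q => chi q != _).
pose key (q : P) := slope w (fsval p) (fsval q).
pose I q r := interior_points [set p; q; r]%SET.
have QP q : q \in Q -> chi q = chi p /\ dotmul2 w (fsval p) < dotmul2 w (fsval q).
  by rewrite inE => /andP[/eqP].
have pQ q : q \in Q -> p != q.
  by move=> /QP[_]; apply: contraTneq => ->; rewrite ltxx.
have kinj : {in Q & , injective key}.
  move=> q r qQ rQ kqr; apply/eqP; apply: contraT => qr; exfalso.
  have [_ pq] := QP _ qQ; have [_ pr] := QP _ rQ.
  apply: (gp (fsval p) (fsval q) (fsval r)); rewrite ?fsvalP //.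
  - by apply: contraNneq (pQ _ qQ) => /val_inj ->.
  - by apply: contraNneq (pQ _ rQ) => /val_inj ->.
  - exact: eq_slope_collinear kqr.
(* A point inside the triangle lies to the right of [p], so it is in [Q] if it has the color of [p]
   and in [U] otherwise. *)
have IP q r z : q \in Q -> r \in Q -> key q < key r -> z \in I q r ->
    key q < key z < key r /\ z \in (Q :|: U)%SET.
  move=> qQ rQ qr; rewrite inE => /set_mem zI.
  have [_ pq] := QP _ qQ; have [_ pr] := QP _ rQ.
  have := interior_triangle_slope _ _ (fsval q) (fsval r) _ _ w0 _ pq pr qr zI.
  case=> [a [b /= + <-]|pz kz].
    rewrite !inE -orbA => /or3P[]/eqP->; [exact: Or31|exact: Or32|exact: Or33].
  by split=> //; rewrite !inE pz andbT orbN.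
have [D [succ [DP card_le]]] := few_interior_consecutive key Q U I s kinj IP.
apply: leq_trans card_le _; rewrite leq_add2r leq_mul2r /=.
pose tri q : {set P} := [set p; q; succ q]%SET.
(* If distinct [q] and [q'] gave the same triangle, each would be the successor of the other, and
   its key would be both larger and smaller. *)
have tri_inj : {in D &, injective tri}.
  move=> q q' /DP[qQ sQ qs _] /DP[q'Q s'Q q's' _] e.
  have : q \in tri q' by rewrite -e !inE eqxx orbT.
  rewrite !inE eq_sym (negPf (pQ _ qQ)) /= => /orP[/eqP//|/eqP qe].
  have : q' \in tri q by rewrite e !inE eqxx orbT.
  rewrite !inE eq_sym (negPf (pQ _ q'Q)) /= => /orP[/eqP//|/eqP q'e].
  by move: qs q's'; rewrite -q'e -qe => /lt_trans /[apply]; rewrite ltxx.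
rewrite -(card_in_imset tri_inj); apply/subset_leq_card/fintype.subsetP => T.
move=> /imsetP[q /DP[qQ sQ qs Is] ->].
have inT x : x \in tri q -> x = p \/ x \in Q.
  rewrite !inE -orbA => /or3P[]/eqP->; [by left|right|right].
    by rewrite inE in qQ.
  by rewrite inE in sQ.
rewrite !inE eqxx /= andbA; apply/andP; split; last first.
  apply/forall_inP => x /inT[->|/QP[_ ->]]; last exact: implybT.
  by rewrite eqxx.
rewrite Is andbT; apply/andP; split.
  rewrite /tri -setUA cardsU1 cards2 !inE negb_or !pQ //=.
  by rewrite (_ : q != succ q) //; apply: contraTneq qs => <-; rewrite ltxx.
have chiE x : x \in tri q -> chi x = chi p by move=> /inT[->|/QP[]].
by apply/forall_inP => x /chiE ->; apply/forall_inP => y /chiE ->.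
Qed.

(** Of two leftmost vertices of one triangle, each would lie strictly to the left of the other. *)
Lemma sum_leftmost_triangles w (A : {set P}) :
  (\sum_(p in A) #|leftmost_triangles w p| <= #|almost_empty_triangles|)%N.
Proof.
apply: sum_card_disjoint => [p _|p q T _ _].
  by apply/fintype.subsetP => T; rewrite inE => /andP[].
rewrite inE => /and3P[_ pT /forall_inP pmin].
rewrite inE => /and3P[_ qT /forall_inP qmin].
apply/eqP; apply: contraT => pq.
have := pmin _ qT; rewrite eq_sym pq /= => /lt_trans /(_ (implyP (qmin _ pT) pq)).
by rewrite ltxx.
Qed.

End Apex.
End Geometry.

(** * The final count and its constants *)

Lemma num_mono_triangles_ge {R : realType} {c : nat} (P : {fset 'rV[R]_2})
    (chi : P -> 'I_c) : (0 < c)%N -> general_position P ->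
  (8 * c ^ 2 <= #|` P|)%N ->
  (#|` P| ^ 2 <= 16 * c ^ 4 * num_mono_triangles (c - 1) chi)%N.
Proof.
move=> c0 gp; rewrite cardfE => nc.
rewrite -[num_mono_triangles _ _]/#|almost_empty_triangles chi (c - 1)|.
have [k nS] := large_color_class chi c0.
set S := finset _ in nS; set m := #|S| in nS.
have [w w0 winj] := generic_direction P.
pose f (p : P) := dotmul2 w (fsval p).
have finj : injective f.
  by move=> p q e; apply: val_inj; apply: winj; rewrite ?fsvalP.
(* The number of apices: small enough that [c * K <= m / 4], yet of order [m / c]. *)
pose K := (m %/ (4 * c))%N.
have mc : (8 * c <= m)%N.
  by rewrite -(leq_pmul2l c0) mulnCA mulnn (leq_trans nc).
have Km : (4 * c * K <= m)%N by rewrite mulnC leq_trunc_div.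
have mK : (m < 4 * c * K.+1)%N by rewrite mulnC ltn_ceil // muln_gt0.
have [|A [AS cardA] Aabove] := many_have_many_above f S K finj.
  by rewrite -/m; nia.
have leftmost p : p \in A -> (m <= 2 * c * #|leftmost_triangles chi (c - 1) w p|)%N.
  move=> pA; have := card_leftmost_triangles chi (c - 1) w p w0 gp.
  have /eqP -> : chi p == k by have := fintype.subsetP AS _ pA; rewrite inE.
  have := Aabove _ pA; rewrite -/m.
  have -> : finset (fun q => (q \in S) && (f p < f q)%R)
      = finset (fun q => (chi q == k)
          && (dotmul2 w (fsval p) < dotmul2 w (fsval q))%R).
    by apply/setP => q; rewrite !inE.
  have -> : finset (fun q => chi q != k) = ~: S by apply/setP => q; rewrite !inE.
  (* With [a >= m - K] and at most [(c - 1) * m] points of other colors, [b * c >= (m - K - 1) * c -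
     (c - 1) * m = m - c * K - c]. Since [c * K <= m / 4] and [c <= m / 8], this exceeds [m / 2]. *)
  have := cardsC S; rewrite -/m subn1 prednK //.
  set a := #|finset _|; set b := #|leftmost_triangles _ _ _ _|; nia.
have KG : (K * m <= 2 * c * #|almost_empty_triangles chi (c - 1)|)%N.
  rewrite -cardA -sum_nat_const.
  apply: leq_trans (leq_sum _ leftmost) _.
  by rewrite -big_distrr /= leq_mul2l sum_leftmost_triangles orbT.
(* The rounding in [K] is absorbed by [8 * c <= m], which turns [m < 4 * c * K.+1] into
   [m <= 8 * c * K]. *)
have mm : (m ^ 2 <= 8 * c * K * m)%N by rewrite expnS expn1 leq_mul2r; nia.
apply: (@leq_trans (c ^ 2 * m ^ 2)); first by rewrite -expnMn leq_exp2r.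
rewrite (_ : 16 * c ^ 4 * _
  = c ^ 2 * (8 * c * (2 * c * #|almost_empty_triangles chi (c - 1)|)))%N.
  by rewrite leq_mul2l (leq_trans mm) ?orbT // -mulnA leq_mul2l KG orbT.
by ring.
Qed.

Theorem theorem1 (R : realType) (c : nat) (hc : (2 <= c)%N) :
  exists2 L : R, 0 < L &
    exists n0 : nat, forall n : nat, (n0 <= n)%N ->
      L * n%:R ^+ 2 <= (min_mono_triangles R c (c - 1) n)%:R.
Proof.
have c0 : (0 < c)%N by exact: ltnW.
have C0 : 0 < (16 * c ^ 4)%:R :> R by rewrite ltr0n muln_gt0 expn_gt0 c0.
exists (16 * c ^ 4)%:R^-1; first by rewrite invr_gt0.
exists (8 * c ^ 2)%N => n nc.
(* As [c] is positive the minimum is attained, so it suffices to bound the count for a minimizing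
   colored set. *)
have [[P [chi [gp Pn <-]]] _] := min_mono_trianglesP R (c - 1) n c0.
rewrite mulrC ler_pdivrMr // mulrC -natrX -natrM ler_nat -Pn.
by apply: num_mono_triangles_ge; rewrite ?Pn.
Qed.
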